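(* Assume $A_0^{-1/2}DA_0^{-1/2}$ is a bounded self-adjoint operator in $H$. (i) If $\beta>0$, then \[ \sigma(\mathcal A)\subset\Big\{\lambda\in\mathbb C\ \Big|\ \mathrm{Re}\,\lambda\le-\frac\beta2\Big\}\cup\Big[-\frac\beta2,0\Big). \] (ii) If $0<\mu<2$, then $\beta\ge\mu a_0>0$ and \[ \sigma(\mathcal A)\subset\Big\{\lambda\in\mathbb C\ \Big|\ \mathrm{Re}\,\lambda\le-\frac\beta2,\ |\mathrm{Im}\,\lambda|\le\frac{\sqrt{4-\mu^2}}\mu\,|\mathrm{Re}\,\lambda|\Big\}\cup\Big[-\frac\beta2,0\Big); \] if $\mu\ge2$, then $\sigma(\mathcal A)\subset(-\infty,0)$. (iii) If $\delta>0$, then $\beta\ge\delta a_0^2>0$, the set $\sigma(\mathcal A)\setminus\mathbb R$ is bounded and confined to a part of a disk, and \[ \sigma(\mathcal A)\subset\Big(-\infty,-\frac2\delta\Big]\cup\Big\{\lambda\in\mathbb C\ \Big|\ -\frac2\delta\le\mathrm{Re}\,\lambda\le-\frac\beta2,\ \Big|\lambda+\frac1\delta\Big|\le\frac1\delta\Big\}\cup\Big[-\frac\beta2,0\Big); \] if $\beta\delta>4$, then \[ \sigma(\mathcal A)\subset\Big(-\infty,-\frac\beta2\Big(1+\sqrt{1-\frac4{\beta\delta}}\Big)\Big]\cup\Big[-\frac\beta2\Big(1-\sqrt{1-\frac4{\beta\delta}}\Big),0\Big). \] If, in any of the cases $\beta>0$, $0<\mu<2$, $\mu\ge2$, or $\delta>0$,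 in addition $\gamma<\infty$, then also \[ \sigma(\mathcal A)\subset\Big[-\gamma,-\frac\gamma2\Big]\cup\Big\{\lambda\in\mathbb C\ \Big|\ -\frac\gamma2\le\mathrm{Re}\,\lambda<0\Big\}. \]
   Context: $H$ is a (complex) Hilbert space with inner product $\langle\cdot,\cdot\rangle$ and norm $\|\cdot\|$. $A_0:\mathcal D(A_0)\subset H\to H$ is a self-adjoint, uniformly positive linear operator with $0\in\rho(A_0)$. $H_{1/2}:=\mathcal D(A_0^{1/2})$ with norm $\|z\|_{H_{1/2}}=\|A_0^{1/2}z\|$ and inner product $\langle x,y\rangle_{H_{1/2}}=\langle A_0^{1/2}x,A_0^{1/2}y\rangle$; $H_{-1/2}$ is the dual of $H_{1/2}$ with respect to the pivot space $H$, i.e. the completion of $H$ with respect to $\|A_0^{-1/2}z\|$ (so $A_0^{-1/2}$ extends to a bounded operator $H_{-1/2}\to H$); $\langle\cdot,\cdot\rangle_{H_{-1/2}\times H_{1/2}}$ is the duality pairing, with $\langle z',z\rangle_{H_{-1/2}\times H_{1/2}}=\langle z',z\rangle$ for $z'\in H$, $z\in H_{1/2}$. $H_1:=\mathcal D(A_0)$. $A_0$ extends to a bounded operator $H_{1/2}\to H_{-1/2}$, again denoted $A_0$. The constant $a_0>0$ is such that $\|A_0^{1/2}z\|\ge a_0\|z\|$ for all $z\in H_{1/2}$. $D:H_{1/2}\to H_{-1/2}$ is a bounded linear operator such that $\mathrm{Re}\,\langle Dz,z\rangle_{H_{-1/2}\times H_{1/2}}\ge 0$ for all $z\in H_{1/2}$,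 and $D$ maps $H_1$ into $H$. The operator $\mathcal A$ in $H_{1/2}\times H$ is $\mathcal A=\begin{bmatrix}0&I\\-A_0&-D\end{bmatrix}$ with $\mathcal D(\mathcal A)=\{(z,w)^\top\in H_{1/2}\times H_{1/2}\mid A_0z+Dw\in H\}$. Constants (with $z$ ranging over $H_{1/2}\setminus\{0\}$ and $\langle Dz,z\rangle$ short for $\langle Dz,z\rangle_{H_{-1/2}\times H_{1/2}}$): \[ \beta=\inf_z\frac{\mathrm{Re}\,\langle Dz,z\rangle}{\|z\|^2},\quad \gamma=\sup_z\frac{\mathrm{Re}\,\langle Dz,z\rangle}{\|z\|^2}\in[0,\infty],\quad \delta=\inf_z\frac{\mathrm{Re}\,\langle Dz,z\rangle}{\|z\|_{H_{1/2}}^2},\quad \mu=\inf_z\frac{\mathrm{Re}\,\langle Dz,z\rangle}{\|z\|\,\|z\|_{H_{1/2}}}. \] *)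

(* Defs.v *)
From mathcomp Require Import all_boot all_order all_algebra sesquilinear.
From mathcomp Require Import complex.
From mathcomp Require Import all_classical all_reals ereal topology normedtype.

Set Implicit Arguments.
Unset Strict Implicit.
Unset Printing Implicit Defensive.

Import Order.TTheory GRing.Theory Num.Theory.
Import numFieldNormedType.Exports.

Local Open Scope classical_set_scope.
Local Open Scope complex_scope.
Local Open Scope ring_scope.

(* MathComp norms on a complex space take values in R[i]; this is the same
   number in R. *)
Definition rnorm (R : realType) (E : normedModType R[i]) (x : E) : R :=
  complex.Re `|x|.

(* Together with completeness of H this says that (H, dot) is a Hilbert space.
   dot is linear in its first and conjugate-linear in its second argument. *)
Definition norm_from_dot (R : realType) (H : normedModType R[i])
    (dot : {dot H for Num.conj}) : Prop :=
  forall x : H, `|x| ^+ 2 = dot x x.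

(* An unbounded operator is represented by its graph: G (x, y) means that x is
   in the domain of G and that G maps x to y. *)
Definition dom (E F : Type) (G : set (E * F)) : set E :=
  [set x | exists y, G (x, y)].

Definition linear_operator (R : realType) (E F : normedModType R[i])
    (G : set (E * F)) : Prop :=
  [/\ G (0, 0),
      forall (c : R[i]) x x' y y',
        G (x, y) -> G (x', y') -> G (c *: x + x', c *: y + y') &
      forall x y y', G (x, y) -> G (x, y') -> y = y'].

Definition bounded_operator (R : realType) (E F : normedModType R[i])
    (G : set (E * F)) : Prop :=
  exists2 Q : {linear E -> F}, continuous Q & G = [set p | p.2 = Q p.1].

(* The graph of G - lambda I. *)
Definition shift (R : realType) (E : normedModType R[i])
    (G : set (E * E)) (lambda : R[i]) : set (E * E) :=
  [set p | G (p.1, p.2 + lambda *: p.1)].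

Definition resolvent_set (R : realType) (E : normedModType R[i])
    (G : set (E * E)) : set R[i] :=
  [set lambda | bounded_operator ((shift G lambda)^-1)%relation].

Definition spectrum (R : realType) (E : normedModType R[i])
    (G : set (E * E)) : set R[i] := ~` resolvent_set G.

Definition adjoint (R : realType) (H : normedModType R[i])
    (dot : {dot H for Num.conj}) (G : set (H * H)) : set (H * H) :=
  [set p | forall x y, G (x, y) -> dot y p.1 = dot x p.2].

Definition self_adjoint (R : realType) (H : normedModType R[i])
    (dot : {dot H for Num.conj}) (G : set (H * H)) : Prop :=
  [/\ linear_operator G, dense (dom G) & G = adjoint dot G].

(* In R[i], a <= b means that b - a is a nonnegative real number. *)
Definition nonneg_operator (R : realType) (H : normedModType R[i])
    (dot : {dot H for Num.conj}) (G : set (H * H)) : Prop :=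
  forall x y, G (x, y) -> 0 <= dot y x.

Definition uniformly_positive (R : realType) (H : normedModType R[i])
    (dot : {dot H for Num.conj}) (G : set (H * H)) : Prop :=
  exists2 c : R, 0 < c &
    forall x y, G (x, y) -> c%:C * `|x| ^+ 2 <= dot y x.

(* S = A0^{1/2}, the nonnegative self-adjoint operator with S^2 = A0,
   domains included. *)
Definition is_sqrt_operator (R : realType) (H : normedModType R[i])
    (dot : {dot H for Num.conj}) (A0 S : set (H * H)) : Prop :=
  [/\ self_adjoint dot S, nonneg_operator dot S & A0 = (S \; S)%relation].

(* i : Hp -> H realizes the inclusion of H_{1/2} = dom S, normed by |S z|. *)
Definition is_half_space (R : realType) (H Hp : normedModType R[i])
    (S : set (H * H)) (i : {linear Hp -> H}) : Prop :=
  [/\ injective i, range i = dom S &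
      forall (z : Hp) (h : H), S (i z, h) -> `|z| = `|h|].

(* j : H -> Hm, with Hm complete, realizes H_{-1/2} as the completion of H
   for the norm |S^{-1} h|. *)
Definition is_minus_half_space (R : realType) (H : normedModType R[i])
    (Hm : completeNormedModType R[i])
    (S : set (H * H)) (j : {linear H -> Hm}) : Prop :=
  dense (range j) /\
  forall x h : H, (S^-1)%relation (h, x) -> `|j h| = `|x|.

(* Density of H in Hm makes such a pairing unique. *)
Definition is_duality_pairing (R : realType) (H Hp Hm : normedModType R[i])
    (dot : {dot H for Num.conj})
    (i : {linear Hp -> H}) (j : {linear H -> Hm})
    (pair : Hm -> Hp -> R[i]) : Prop :=
  (forall z : Hp, linear (pair^~ z : Hm -> R[i]^o) /\
                  continuous (pair^~ z : Hm -> R[i]^o)) /\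
  (forall (h : H) (z : Hp), pair (j h) z = dot h (i z)).

(* The bounded extension Hm -> H of S^{-1}. *)
Definition extends_inv_sqrt (R : realType) (H Hm : normedModType R[i])
    (S : set (H * H)) (j : {linear H -> Hm}) (Sm : {linear Hm -> H}) : Prop :=
  continuous Sm /\
  forall x h : H, (S^-1)%relation (h, x) -> Sm (j h) = x.

(* The bounded extension Hp -> Hm of A0. *)
Definition extends_A0 (R : realType) (H Hp Hm : normedModType R[i])
    (A0 : set (H * H)) (i : {linear Hp -> H}) (j : {linear H -> Hm})
    (A0e : {linear Hp -> Hm}) : Prop :=
  continuous A0e /\
  forall (z : Hp) (h : H), A0 (i z, h) -> A0e z = j h.

(* The operator A0^{-1/2} D A0^{-1/2} in H: x |-> Sm (D (S^{-1} x)). *)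
Definition sandwiched (R : realType) (H Hp Hm : normedModType R[i])
    (S : set (H * H)) (i : {linear Hp -> H}) (Sm : {linear Hm -> H})
    (D : {linear Hp -> Hm}) : set (H * H) :=
  [set p | exists2 z : Hp, (S^-1)%relation (p.1, i z) & p.2 = Sm (D z)].

(* The block operator [0, I; -A0, -D] in H_{1/2} x H. Its domain consists of the
   (z, i w) such that A0 z + D w lies in H, i.e. in the range of j. The product
   space carries MathComp's maximum norm, which is equivalent to the Hilbert
   space norm, so boundedness and the spectrum are the same. *)
Definition block_operator (R : realType) (H Hp Hm : normedModType R[i])
    (i : {linear Hp -> H}) (j : {linear H -> Hm})
    (A0e D : {linear Hp -> Hm}) : set ((Hp * H) * (Hp * H)) :=
  [set p | exists (z w : Hp) (h : H),
     p = ((z, i w), (w, h)) /\ j h = - A0e z - D w].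

Definition re_form (R : realType) (Hp Hm : normedModType R[i])
    (pair : Hm -> Hp -> R[i]) (D : {linear Hp -> Hm}) (z : Hp) : R :=
  complex.Re (pair (D z) z).

(* On the zero space the real infima below are 0 by convention; the spectrum of
   the block operator is then empty. *)
Definition beta (R : realType) (H Hp Hm : normedModType R[i])
    (i : {linear Hp -> H}) (pair : Hm -> Hp -> R[i]) (D : {linear Hp -> Hm}) : R :=
  inf [set re_form pair D z / rnorm (i z) ^+ 2 | z in [set z : Hp | z != 0]].

Definition gamma (R : realType) (H Hp Hm : normedModType R[i])
    (i : {linear Hp -> H}) (pair : Hm -> Hp -> R[i]) (D : {linear Hp -> Hm}) :
    \bar R :=
  ereal_sup [set (re_form pair D z / rnorm (i z) ^+ 2)%:E
            | z in [set z : Hp | z != 0]].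

Definition delta (R : realType) (Hp Hm : normedModType R[i])
    (pair : Hm -> Hp -> R[i]) (D : {linear Hp -> Hm}) : R :=
  inf [set re_form pair D z / rnorm z ^+ 2 | z in [set z : Hp | z != 0]].

Definition mu (R : realType) (H Hp Hm : normedModType R[i])
    (i : {linear Hp -> H}) (pair : Hm -> Hp -> R[i]) (D : {linear Hp -> Hm}) : R :=
  inf [set re_form pair D z / (rnorm (i z) * rnorm z)
      | z in [set z : Hp | z != 0]].

(* A set of real numbers viewed in the complex plane. *)
Definition on_real_line (R : realType) (X : set R) : set R[i] :=
  [set x%:C | x in X].

(* Main.v *)
From HB Require Import structures.
Require Import Defs.
From mathcomp Require Import all_boot all_order all_algebra sesquilinear.
From mathcomp Require Import complex ring lra.
From mathcomp Require Import all_classical all_reals ereal topology normedtype.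
From mathcomp Require Import sequences derive.

(** Transport everything to bounded operators on H.  Let R = A0^{-1/2}, a
bounded symmetric operator, and let T = A0^{-1/2} D A0^{-1/2}.  Writing a
vector of H_{1/2} as z = V x, where V is the inverse of the isometry
z |-> A0^{1/2} z, and eliminating the second component, the equation for the
resolvent of the block operator at l becomes L(l) x = y with the quadratic
pencil

  L(l) = 1 + l T + l^2 R^2,

so l is in the resolvent set as soon as L(l) has a bounded inverse
([resolvent_of_pencil]).

Since T and R^2 are symmetric, the adjoint of L(l) is L(conj l), and
<L(l) x, x> = |x|^2 (1 + l t + l^2 b), where t = <Tx, x> / |x|^2 and
b = |Rx|^2 / |x|^2 are real.  If |1 + l t + l^2 b| stays above a positive
constant, then so does the same quantity for conj l, both L(l) and its adjoint
are bounded below, and L(l) is invertible ([bijective_of_bounded_below],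
[resolvent_of_coercive]).  Hence at a spectral point l this quantity gets
arbitrarily small.  The pairs (t, b) form a bounded set of the plane because T
and R are bounded; by compactness l is an exact root of 1 + l t + l^2 b for some
(t, b) in the closure of that set ([spectrum_root]).

What remains is plane algebra.  Each of the constants beta, gamma, delta and mu
gives an inequality between t and b that survives in the closure:
t >= beta b, t <= gamma b, t >= delta, t^2 >= mu^2 b.  A real root is negative
because t and b are nonnegative.  A nonreal root l = u + iv satisfies
t = - 2 u b and b |l|^2 = 1, so that, for example, t >= beta b reads
u <= - beta / 2, and t >= delta says that l lies in the disk of radius
1 / delta centred at - 1 / delta. *)

Set Implicit Arguments.
Unset Strict Implicit.
Unset Printing Implicit Defensive.

Import Order.TTheory GRing.Theory Num.Theory.
Import numFieldNormedType.Exports.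

Local Open Scope classical_set_scope.
Local Open Scope complex_scope.
Local Open Scope ring_scope.

(** * Real-valued norms and bounded linear maps *)

Section norms.
Context {R : realType}.
Implicit Types V W : normedModType R[i].

Lemma normE V (x : V) : `|x| = (rnorm x)%:C.
Proof. by rewrite /rnorm RRe_real// normr_real. Qed.

Lemma rnorm_ge0 V (x : V) : 0 <= rnorm x.
Proof. by rewrite -ler0c -normE. Qed.

Lemma rnorm_eq0 V (x : V) : (rnorm x == 0) = (x == 0).
Proof. by rewrite -(inj_eq (@complexI R)) -normE normr_eq0. Qed.

Lemma rnorm_gt0 V (x : V) : (0 < rnorm x) = (x != 0).
Proof. by rewrite lt_def rnorm_eq0 rnorm_ge0 andbT. Qed.

Lemma rnorm0 V : rnorm (0 : V) = 0.
Proof. by apply/eqP; rewrite rnorm_eq0. Qed.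

Lemma rnormD V (x y : V) : rnorm (x + y) <= rnorm x + rnorm y.
Proof. by rewrite -lecR rmorphD/= -!normE ler_normD. Qed.

Lemma rnormN V (x : V) : rnorm (- x) = rnorm x.
Proof. by rewrite /rnorm normrN. Qed.

Lemma rnormZ V (c : R[i]) (x : V) : rnorm (c *: x) = complex.Re `|c| * rnorm x.
Proof.
by apply: complexI; rewrite rmorphM/= -normE normrZ normE RRe_real// normr_real.
Qed.

Lemma rnormZ_ge0 V (r : R) (x : V) : 0 <= r -> rnorm (r%:C *: x) = r * rnorm x.
Proof. by move=> r0; rewrite rnormZ ger0_norm ?ler0c. Qed.

Lemma linear_continuousP V W (f : {linear V -> W}) :
  continuous f <-> exists2 K : R, 0 < K & forall x, rnorm (f x) <= K * rnorm x.
Proof.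
rewrite -linear_bounded_continuous linear_boundedP; split.
  move=> /pinfty_ex_gt0[K K0 fK]; have /complex_realP[k kE] := gtr0_real K0.
  exists k => [|x]; first by rewrite -ltcR -kE.
  by rewrite -lecR rmorphM/= -kE -!normE.
move=> [k k0 fk]; exists k%:C; split.
  by apply/complex_realP; exists k.
move=> r /ltW kr x; rewrite (le_trans _ (ler_wpM2r _ kr))//.
by rewrite !normE -rmorphM lecR.
Qed.

End norms.

(** Approximate solutions of L x = y with errors tending to 0 form a Cauchy
sequence, because L is bounded below; their limit is an exact solution. *)
Lemma bounded_below_surjective {R : realType} (V : completeNormedModType R[i])
    (W : normedModType R[i]) (L : {linear V -> W}) (c : R) :
  0 < c -> continuous L -> (forall x, c * rnorm x <= rnorm (L x)) ->
  (forall y (e : R), 0 < e -> exists x, rnorm (y - L x) <= e) ->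
  forall y, exists x, L x = y.
Proof.
move=> c0 Lc Lbelow Ldense y.
have /choice[X XP] : forall n : nat, exists x, rnorm (y - L x) <= n.+1%:R^-1.
  by move=> n; apply: Ldense; rewrite invr_gt0.
have dX m n : rnorm (X m - X n) <= c^-1 * (m.+1%:R^-1 + n.+1%:R^-1).
  rewrite ler_pdivlMl// (le_trans (Lbelow _))// linearB.
  have -> : L (X m) - L (X n) = - (y - L (X m)) + (y - L (X n)).
    by rewrite opprB addrA subrK.
  by rewrite (le_trans (rnormD _ _))// rnormN lerD.
have Xsmall (e : R) : 0 < e -> \forall n \near \oo, n.+1%:R^-1 < e.
  move=> e0; near=> n; rewrite invf_plt ?posrE//.
  rewrite (lt_le_trans (truncnS_gt _))// ler_nat ltnS.
  by near: n; exact: nbhs_infty_ge.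
have Xcvg : cvg (X @ \oo).
  apply/cauchy_cvgP; apply/cauchy_ballP => e e0.
  have /complex_realP[d dE] := gtr0_real e0.
  have d0 : 0 < d by rewrite -ltcR -dE.
  near_simpl; near=> m n => /=; rewrite -ball_normE /ball_/= normE dE ltcR.
  rewrite (le_lt_trans (dX _ _))// ltr_pdivrMl// [ltRHS]splitr ltrD//.
    by near: m; apply: Xsmall; rewrite divr_gt0// mulr_gt0.
  by near: n; apply: Xsmall; rewrite divr_gt0// mulr_gt0.
set x := lim (X @ \oo); exists x.
have LXx : (L \o X) @ \oo --> L x.
  by apply: continuous_cvg => //; exact: Lc.
have LXy : (L \o X) @ \oo --> y.
  apply/cvgrPdist_le => e e0; have /complex_realP[d dE] := gtr0_real e0.
  near=> n => /=; rewrite normE dE lecR (le_trans (XP n))// ltW//.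
  by near: n; apply: Xsmall; rewrite -ltcR -dE.
exact: (cvg_unique _ LXx LXy).
Unshelve. all: by end_near. Qed.

(** * Invertibility of operators bounded below together with their adjoint *)

Lemma modulusE (R : realType) (z : R[i]) : `|z| = (complex.Re `|z|)%:C.
Proof. by rewrite RRe_real// normr_real. Qed.

Lemma modulus_ge0 (R : realType) (z : R[i]) : 0 <= complex.Re `|z|.
Proof. by rewrite -ler0c -modulusE. Qed.

Section hilbert.
Context {R : realType} (H : completeNormedModType R[i]).
Variable (dot : {dot H for Num.conj}).
Hypothesis hH : norm_from_dot dot.

Lemma dot_self (x : H) : dot x x = (rnorm x ^+ 2)%:C.
Proof. by rewrite -hH normE rmorphXn. Qed.

Lemma dotC (x y : H) : dot x y = (dot y x)^*%C.
Proof. by rewrite hermC expr0 mul1r. Qed.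

(** The squared norm of the component of x orthogonal to y is nonnegative. *)
Lemma dot_cauchy_schwarz (x y : H) :
  complex.Re `|dot x y| <= rnorm x * rnorm y.
Proof.
have [->|y0] := eqVneq y 0.
  by rewrite linear0r normr0 mulr_ge0 ?rnorm_ge0.
have yy0 : 0 < dot y y by rewrite dnorm_gt0.
set a := dot x y / dot y y.
have axy : dot (x - a *: y) y = 0.
  by rewrite linearBl linearZl_LR/= divfK ?subrr// gt_eqF.
have := dnorm_ge0 dot (x - a *: y).
rewrite {2}[x - _]/GRing.add/= linearBr linearZr_LR/= axy mulr0 subr0.
rewrite linearBl linearZl_LR/= [dot y x]dotC subr_ge0.
rewrite mulrAC -sqr_normc ler_pdivrMr// !dot_self -rmorphM/= -exprMn.
rewrite [`|_|]modulusE -rmorphXn lecR/=.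
by rewrite ler_pXn2r ?nnegrE ?mulr_ge0 ?rnorm_ge0 ?modulus_ge0.
Qed.

Lemma rnormB_sqr (x y : H) :
  rnorm (x - y) ^+ 2 =
  rnorm x ^+ 2 - 2 * complex.Re (dot y x) + rnorm y ^+ 2.
Proof.
apply: complexI; rewrite -dot_self dnormB !dot_self.
rewrite [dot x y]dotC -[Num.conj _]/(conjc _) conjcK addrC.
rewrite [_^*%C + _]addrC addcJ.
by rewrite rmorphD rmorphB (rmorphM (real_complex R) 2)/= rmorph_nat addrC
  addrAC.
Qed.

(** One step of gradient descent for L z = y replaces the residual r by
r - K^-2 L L' r.  With L' adjoint to L, its squared norm is
|r|^2 - 2 K^-2 |L' r|^2 + K^-4 |L L' r|^2 <= |r|^2 - K^-2 |L' r|^2, and L' is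
bounded below. *)
Lemma gradient_step_contracts (L L' : {linear H -> H}) (c K : R) (x : H) :
  (forall x y, dot (L x) y = dot x (L' y)) ->
  0 <= c -> (forall x, c * rnorm x <= rnorm (L' x)) ->
  0 < K -> (forall x, rnorm (L x) <= K * rnorm x) ->
  rnorm (x - (K ^- 2)%:C *: L (L' x)) ^+ 2 <=
  (1 - (c / K) ^+ 2) * rnorm x ^+ 2.
Proof.
move=> LL' c0 L'below K0 Lbd.
have K2 : 0 < K ^- 2 by rewrite invr_gt0 exprn_gt0.
have dotE : complex.Re (dot ((K ^- 2)%:C *: L (L' x)) x) =
    K ^- 2 * rnorm (L' x) ^+ 2.
  by rewrite linearZl_LR/= LL' dot_self -rmorphM.
rewrite rnormB_sqr rnormZ_ge0 ?(ltW K2)// dotE exprMn.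
have b1 : rnorm (L (L' x)) ^+ 2 <= K ^+ 2 * rnorm (L' x) ^+ 2.
  by rewrite -exprMn ler_pXn2r ?nnegrE ?mulr_ge0 ?rnorm_ge0// ltW.
have b2 : c ^+ 2 * rnorm x ^+ 2 <= rnorm (L' x) ^+ 2.
  by rewrite -exprMn ler_pXn2r ?nnegrE ?mulr_ge0 ?rnorm_ge0.
have b3 : K ^- 2 * (K ^+ 2 * rnorm (L' x) ^+ 2) = rnorm (L' x) ^+ 2.
  by rewrite mulKf// expf_neq0// lt0r_neq0.
have := ler_wpM2l (ltW K2) b2.
have := ler_wpM2l (ltW K2) (ler_wpM2l (ltW K2) b1).
rewrite b3 [(c / K) ^+ 2]exprMn exprVn; nra.
Qed.


(** Gradient descent makes the residual of L z = y as small as desired, so the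
range of L is dense; as L is bounded below, L is onto with bounded inverse.
This replaces the usual argument through orthogonal complements. *)
Lemma bijective_of_bounded_below (L L' : {linear H -> H}) (c : R) :
  (forall x y, dot (L x) y = dot x (L' y)) -> continuous L ->
  0 < c -> (forall x, c * rnorm x <= rnorm (L x)) ->
  (forall x, c * rnorm x <= rnorm (L' x)) ->
  exists Q : {linear H -> H}, [/\ continuous Q, cancel L Q & cancel Q L].
Proof.
move=> LL' Lc c0 Lbelow L'below.
have Linj : injective L.
  move=> x y Lxy; apply/eqP; rewrite -subr_eq0 -rnorm_eq0 eq_le rnorm_ge0 andbT.
  by rewrite -(ler_pM2l c0) mulr0 (le_trans (Lbelow _))// linearB Lxy subrr
    rnorm0.
have [K0 K00 K0bd] := (linear_continuousP L).1 Lc.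
(* The summand c keeps the contraction factor 1 - (c / K)^2 positive. *)
pose K := c + K0; have Kgt0 : 0 < K by rewrite addr_gt0.
have Kbd x : rnorm (L x) <= K * rnorm x.
  by rewrite (le_trans (K0bd x))// ler_wpM2r ?rnorm_ge0// lerDr ltW.
pose q := 1 - (c / K) ^+ 2.
have cK : 0 < c / K < 1.
  by rewrite divr_gt0//= ltr_pdivrMr// mul1r ltrDl.
have q01 : 0 <= q < 1.
  by rewrite /q; move: (c / K) cK => z /andP[z0 z1]; apply/andP; split; nra.
have Ldense y (e : R) : 0 < e -> exists x, rnorm (y - L x) <= e.
  move=> e0.
  have res n : exists x, rnorm (y - L x) ^+ 2 <= q ^+ n * rnorm y ^+ 2.
    elim: n => [|n [x IH]]; first by exists 0; rewrite linear0 subr0 mul1r.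
    exists (x + (K ^- 2)%:C *: L' (y - L x)).
    rewrite linearD linearZ/= opprD addrA.
    rewrite (le_trans (gradient_step_contracts _ LL' (ltW c0) L'below Kgt0 Kbd))//.
    by rewrite -/q [q ^+ n.+1]exprS -mulrA ler_wpM2l//; case/andP: q01.
  have [->|y0] := eqVneq y 0; first by exists 0; rewrite linear0 subrr rnorm0 ltW.
  have yy0 : 0 < rnorm y ^+ 2 by rewrite exprn_gt0// rnorm_gt0.
  have ey0 : 0 < e ^+ 2 / rnorm y ^+ 2 by rewrite divr_gt0// exprn_gt0.
  have /cvgrPdist_le/(_ _ ey0) : q ^+ n @[n --> \oo] --> 0.
    by apply: cvg_expr; rewrite ger0_norm; case/andP: q01.
  case=> N _ /(_ N (leqnn N)).
  rewrite /= sub0r normrN ger0_norm ?exprn_ge0//; last by case/andP: q01.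
  rewrite ler_pdivlMr// => qN; have [x xN] := res N; exists x.
  by rewrite -(@ler_pXn2r _ 2) ?nnegrE ?rnorm_ge0 ?(ltW e0)// (le_trans xN).
have /choice[Q LQ] := bounded_below_surjective c0 Lc Lbelow Ldense.
have QL : cancel L Q by move=> x; apply: Linj; rewrite LQ.
have Qlin : linear Q by move=> a x y; apply: Linj; rewrite linearP !LQ.
pose Ql := HB.pack_for {linear H -> H} Q (GRing.isLinear.Build _ _ _ _ Q Qlin).
exists Ql; split => //; apply/linear_continuousP; exists c^-1; rewrite ?invr_gt0//.
by move=> x; rewrite ler_pdivlMl// (le_trans (Lbelow _))// /= LQ.
Qed.

End hilbert.

(** * Roots of the scalar quadratic *)

Section plane.
Context {R : realType}.
Implicit Types (l : R[i]) (t b : R).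

Definition qeval l (p : R * R) : R[i] := 1 + l * p.1%:C + l ^+ 2 * p.2%:C.

Lemma qevalE (u v t b : R) :
  qeval (u +i* v) (t, b) =
  (1 + u * t + (u ^+ 2 - v ^+ 2) * b) +i* (v * (t + 2 * u * b)).
Proof.
by rewrite /qeval; simpc; rewrite /= expr2; simpc; congr (_ +i* _); ring.
Qed.

Lemma qeval_eq0 (u v t b : R) : qeval (u +i* v) (t, b) = 0 ->
  1 + u * t + (u ^+ 2 - v ^+ 2) * b = 0 /\ v * (t + 2 * u * b) = 0.
Proof. by rewrite qevalE => -[]. Qed.

Lemma qeval_continuous l : continuous (fun p => complex.Re `|qeval l p| ^+ 2).
Proof.
case: l => u v.
have -> : (fun p => complex.Re `|qeval (u +i* v) p| ^+ 2) =
    (fun p : R * R => (1 + u * p.1 + (u ^+ 2 - v ^+ 2) * p.2) ^+ 2 +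
               (v * (p.1 + 2 * u * p.2)) ^+ 2).
  apply/funext => -[t b]; rewrite qevalE normc_def/= sqr_sqrtr//.
  by rewrite addr_ge0 ?sqr_ge0.
have c1 p : fst @ nbhs (p : R * R) --> p.1 by exact: cvg_fst.
have c2 p : snd @ nbhs (p : R * R) --> p.2 by exact: cvg_snd.
move=> p; apply: cvgD; apply: cvgM.
- apply: cvgD; last by apply: cvgMl_tmp; exact: c2.
  by apply: cvgD; [exact: cvg_cst|apply: cvgMl_tmp; exact: c1].
- apply: cvgD; last by apply: cvgMl_tmp; exact: c2.
  by apply: cvgD; [exact: cvg_cst|apply: cvgMl_tmp; exact: c1].
- apply: cvgMl_tmp; apply: cvgD; first exact: c1.
  by apply: cvgMl_tmp; exact: c2.
- apply: cvgMl_tmp; apply: cvgD; first exact: c1.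
  by apply: cvgMl_tmp; exact: c2.
Qed.

Lemma closure_ge0 (W : set (R * R)) (phi : R * R -> R) : continuous phi ->
  (forall p, W p -> 0 <= phi p) -> forall p, closure W p -> 0 <= phi p.
Proof.
move=> phic Wphi.
have cl : closed (phi @^-1` [set x | 0 <= x]).
  by apply: preimage_closed; [move=> ? _; exact: phic|exact: closed_ge].
move=> p Wp; suff : (phi @^-1` [set x | 0 <= x]) p by [].
by rewrite ((closure_id _).1 cl); exact: closureS Wp.
Qed.

(** The modulus of the quadratic attains its minimum on the compact closure of
W, and values arbitrarily close to 0 on W force this minimum to be 0. *)
Lemma root_in_closure (W : set (R * R)) (M : R) l :
  (forall p, W p -> (0 <= p.1 <= M) /\ (0 <= p.2 <= M)) ->
  (forall c, 0 < c -> exists2 p, W p & complex.Re `|qeval l p| < c) ->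
  exists2 p, closure W p & qeval l p = 0.
Proof.
move=> WM Wsmall.
have cW : compact (closure W).
  apply: (@subclosed_compact _ _ (`[0, M] `*` `[0, M])).
  - exact: closed_closure.
  - by apply: compact_setX; exact: segment_compact.
  - have /closure_id -> : closed (`[0, M] `*` `[0, M] : set (R * R)).
      apply: compact_closed; first exact: norm_hausdorff.
      by apply: compact_setX; exact: segment_compact.
    apply: closureS => p /WM[p1 p2]; split; rewrite /= in_itv/=.
      exact: p1.
    exact: p2.
have W0 : closure W !=set0.
  by have [p Wp _] := Wsmall 1 ltr01; exists p; exact: subset_closure.
have [p /set_mem pW pmin] := compact_EVT_min W0 cW
  (continuous_subspaceT (@qeval_continuous l)).
exists p => //; apply/eqP/negPn/negP => qp0.
have qp : 0 < complex.Re `|qeval l p| by rewrite -ltcR -modulusE normr_gt0.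
have [q Wq ql] := Wsmall _ qp.
have /pmin : q \in closure W by apply/mem_set/subset_closure.
by rewrite ler_pXn2r ?nnegrE ?modulus_ge0// leNgt ql.
Qed.

Section root.
Variables (u v t b : R).
Hypotheses (b_ge0 : 0 <= b) (t_ge0 : 0 <= t).
Hypothesis (root : qeval (u +i* v) (t, b) = 0).

Lemma real_root : v = 0 -> u < 0 /\ 1 + u * t + u ^+ 2 * b = 0.
Proof.
have [E1 _] := qeval_eq0 root; move=> v0.
move: E1; rewrite v0 expr0n subr0 => E1; split=> //.
rewrite ltNge; apply/negP => u0.
have := mulr_ge0 u0 t_ge0; have := mulr_ge0 (sqr_ge0 u) b_ge0; lra.
Qed.

(** For a nonreal root the conjugate is the other root, so the sum 2u and the
product u^2 + v^2 of the roots are - t / b and 1 / b. *)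
Lemma nonreal_root : v != 0 ->
  [/\ 0 < b, t = - (2 * u * b) & b * (u ^+ 2 + v ^+ 2) = 1].
Proof.
have [E1 E2] := qeval_eq0 root; move=> v0.
have t0 : t + 2 * u * b = 0.
  by move/eqP: E2; rewrite mulf_eq0 (negPf v0) => /eqP.
have {}t0 : t = - (2 * u * b) by apply/eqP; rewrite -addr_eq0 t0.
have E3 : b * (u ^+ 2 + v ^+ 2) = 1.
  by move: E1; rewrite t0; lra.
split=> //; rewrite lt_def b_ge0 andbT; apply/eqP => b0.
by move: E3; rewrite b0 mul0r => /esym/eqP; rewrite oner_eq0.
Qed.

Lemma nonreal_root_beta (be : R) : be * b <= t -> v != 0 -> u <= - (be / 2).
Proof.
move=> bt /nonreal_root[b0 tE _]; rewrite -(ler_pM2r b0).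
by move: bt; rewrite tE; lra.
Qed.

Lemma nonreal_root_mu (m : R) : 0 < m -> m ^+ 2 * b <= t ^+ 2 -> v != 0 ->
  m ^+ 2 * v ^+ 2 <= (4 - m ^+ 2) * u ^+ 2.
Proof.
move=> m0 mt /nonreal_root[b0 tE bE].
have : m ^+ 2 <= 4 * u ^+ 2 * b.
  by rewrite -(ler_pM2r b0); move: mt; rewrite tE; nra.
have h : 0 <= u ^+ 2 + v ^+ 2 by rewrite addr_ge0 ?sqr_ge0.
move=> /(ler_wpM2r h).
have -> : 4 * u ^+ 2 * b * (u ^+ 2 + v ^+ 2) = 4 * u ^+ 2.
  by rewrite -[RHS]mulr1 -[X in _ = _ * X]bE; ring.
lra.
Qed.

Lemma nonreal_root_delta (d : R) : 0 < d -> d <= t -> v != 0 ->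
  d * (u ^+ 2 + v ^+ 2) + 2 * u <= 0.
Proof.
move=> d0 dt /nonreal_root[b0 tE bE].
have h : 0 <= u ^+ 2 + v ^+ 2 by rewrite addr_ge0 ?sqr_ge0.
by move: (ler_wpM2r h dt); rewrite tE; nra.
Qed.

(** Here t^2 >= beta delta b > 4 b makes the roots real.  For a real root
u > - beta, inserting u^2 b <= u^2 t / beta into - u t = 1 + u^2 b bounds
t (- u) (beta + u) by beta, and t >= delta then gives the quadratic
inequality. *)
Lemma root_beta_delta (be d : R) : 0 < be -> 0 < d -> 4 < be * d ->
  be * b <= t -> d <= t ->
  [/\ v = 0, u < 0 & 0 <= u ^+ 2 + be * u + be / d].
Proof.
move=> be0 d0 bd bt dt.
have v0 : v = 0.
  apply/eqP; apply/negPn/negP => v0; have [bp tE bE] := nonreal_root v0.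
  have h1 : be * b * d <= t ^+ 2.
    by rewrite expr2 ler_pM// ?mulr_ge0// ltW.
  have h2 : 4 * b < be * d * b by rewrite ltr_pM2r.
  have h3 : t ^+ 2 <= 4 * b.
    have -> : 4 * b = 4 * b * (b * (u ^+ 2 + v ^+ 2)) by rewrite bE mulr1.
    rewrite tE; have := sqr_ge0 (b * v); lra.
  by lra.
have [u0 E] := real_root v0; split=> //.
have [ube|ube] := lerP u (- be).
  have : 0 <= be / d by rewrite divr_ge0 ?ltW.
  nra.
have h1 : - u * (be + u) * d <= be.
  have k1 : u ^+ 2 * (be * b) <= u ^+ 2 * t by rewrite ler_wpM2l ?sqr_ge0.
  have k2 : - u * (be + u) * d <= - u * (be + u) * t.
    by rewrite ler_wpM2l// mulr_ge0; lra.
  by nra.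
by move: h1; rewrite -ler_pdivlMr//; lra.
Qed.

Lemma root_gamma (g : R) : t <= g * b ->
  v = 0 /\ - g <= u < 0 \/ v != 0 /\ - (g / 2) <= u.
Proof.
move=> tg; have [v0|v0] := eqVneq v 0; last first.
  right; split=> //; have [b0 tE _] := nonreal_root v0.
  by rewrite -(ler_pM2r b0); move: tg; rewrite tE; lra.
left; have [u0 E] := real_root v0.
have b0 : 0 < b.
  by rewrite lt_def b_ge0 andbT; apply/eqP => b0; move: tg E; rewrite b0; nra.
by split=> //; rewrite u0 andbT -(ler_pM2r b0); nra.
Qed.

End root.
End plane.

(** * From the block operator to the quadratic pencil *)

Lemma continuous_dense_eq (T U : topologicalType) (f g : T -> U) (A : set T) :
  hausdorff_space U -> continuous f -> continuous g -> dense A ->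
  (forall x, A x -> f x = g x) -> forall x, f x = g x.
Proof.
move=> hU fc gc dA fg x; apply: hU => B C fB gC.
have : nbhs x (f @^-1` B `&` g @^-1` C).
  by apply: filterI; [exact: fc|exact: gc].
rewrite nbhsE => -[O [Oo Ox] Osub].
have [a [Oa Aa]] := dA O (ex_intro _ x Ox) Oo.
have [fa ga] := Osub a Oa.
by exists (f a); split => //; rewrite fg.
Qed.

(** A0 = S S is onto because 0 is in its resolvent set, hence so is S.  The
map V sends x to the element of H_{1/2} with S z = x, that is V = S^{-1} with
values in H_{1/2}; the norm of H_{1/2} makes it isometric. *)
Lemma half_space_isometry (R : realType) (H : normedModType R[i])
    (dot : {dot H for Num.conj}) (A0 S : set (H * H))
    (Hp : normedModType R[i]) (i : {linear Hp -> H}) :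
  resolvent_set A0 0 -> is_sqrt_operator dot A0 S -> is_half_space S i ->
  exists V : {linear H -> Hp},
    [/\ forall x, S (i (V x), x), forall x, rnorm (V x) = rnorm x &
        forall z, exists x, z = V x].
Proof.
move=> [Q _ /seteqP[_ QA0]] [[[S00 Slin Sfun] _ _] _ A0E] [iinj irange inorm].
have Sonto x : exists z, S (i z, x).
  have /= : Defs.shift A0 0 (Q x, x) by exact: (QA0 (x, Q x)).
  rewrite /Defs.shift/= scale0r addr0 A0E => -[h _ Sh].
  have : dom S h by exists x.
  by rewrite -irange => -[z _ zh]; exists z; rewrite zh.
have Suniq z z' x : S (i z, x) -> S (i z', x) -> z = z'.
  move=> Sz Sz'; apply/eqP; rewrite -subr_eq0 -normr_eq0.
  have := Slin (-1) _ _ _ _ Sz' Sz; rewrite !scaleN1r addrC [- x + x]addrC subrr.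
  by rewrite -linearB => /inorm ->; rewrite normr0.
have /choice[V SV] := Sonto.
have Vlin : linear V.
  move=> a x y; apply: (Suniq _ _ (a *: x + y)) => //.
  by rewrite linearP; exact: Slin (SV x) (SV y).
exists (HB.pack_for {linear H -> Hp} V (GRing.isLinear.Build _ _ _ _ V Vlin)).
split=> [x|x|z] /=; first exact: SV.
  by rewrite /rnorm (inorm _ _ (SV x)).
have : dom S (i z) by rewrite -irange; exists z.
by move=> [x Szx]; exists x; apply: Suniq Szx (SV x).
Qed.

Lemma conj_quadratic (R : realType) (l : R[i]) (p q r : R) :
  p%:C + l^*%C * q%:C + l^*%C ^+ 2 * r%:C =
  (p%:C + l * q%:C + l ^+ 2 * r%:C)^*%C.
Proof.
by case: l => u v; rewrite !expr2; simpc; congr (_ +i* _); ring.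
Qed.

Lemma qeval_scale (R : realType) (l : R[i]) (n t b : R) : n != 0 ->
  n%:C + l * t%:C + l ^+ 2 * b%:C = n%:C * qeval l (t / n, b / n).
Proof.
move=> n0; have scale a : a%:C = n%:C * (a / n)%:C.
  by rewrite -rmorphM/= mulrC divfK.
by rewrite (scale t) (scale b) /qeval/= !mulrDr mulr1 !(mulrCA n%:C).
Qed.

Section operators.
Context {R : realType} (H : completeNormedModType R[i]).
Context (dot : {dot H for Num.conj}).
Context (A0 S : set (H * H)) (a0 : R).
Context (Hp Hm : completeNormedModType R[i]).
Context (i : {linear Hp -> H}) (j : {linear H -> Hm}).
Context (pair : Hm -> Hp -> R[i]).
Context (Sm : {linear Hm -> H}) (A0e D : {linear Hp -> Hm}).
Hypothesis hH : norm_from_dot dot.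
Hypothesis hS : is_sqrt_operator dot A0 S.
Hypothesis a0_gt0 : 0 < a0.
Hypothesis ha0 : forall x h : H, S (x, h) -> a0 * rnorm x <= rnorm h.
Hypothesis hHm : is_minus_half_space S j.
Hypothesis hpair : is_duality_pairing dot i j pair.
Hypothesis hSm : extends_inv_sqrt S j Sm.
Hypothesis hA0e : extends_A0 A0 i j A0e.
Hypothesis D_bounded : continuous D.
Hypothesis T_sa : self_adjoint dot (sandwiched S i Sm D).
Context (V : {linear H -> Hp}).
Hypothesis SV : forall x, S (i (V x), x).
Hypothesis normV : forall x, rnorm (V x) = rnorm x.
Hypothesis surjV : forall z, exists x, z = V x.

Lemma V_continuous : continuous V.
Proof.
by apply/linear_continuousP; exists 1 => // x; rewrite mul1r normV.
Qed.

Lemma i_bound z : a0 * rnorm (i z) <= rnorm z.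
Proof. by have [x ->] := surjV z; rewrite normV; apply: ha0. Qed.

Lemma i_continuous : continuous i.
Proof.
apply/linear_continuousP; exists a0^-1; rewrite ?invr_gt0// => z.
by rewrite ler_pdivlMl// i_bound.
Qed.

Lemma iV_symmetric x y : dot (i (V x)) y = dot x (i (V y)).
Proof.
have [[_ _ Sadj] _ _] := hS.
have := SV y; rewrite {1}Sadj => /(_ _ _ (SV x)) /= ->; exact: erefl.
Qed.

Lemma Sm_j h : Sm (j h) = i (V h).
Proof. exact: hSm.2 (SV h). Qed.

(** The norm of H_{-1/2} makes Sm isometric on the dense subspace j(H). *)
Lemma Sm_isometry m : rnorm (Sm m) = rnorm m.
Proof.
rewrite /rnorm; congr complex.Re; move: m.
apply: (@continuous_dense_eq _ R[i]^o (fun m => `|Sm m|) (fun m => `|m|) (range j)).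
- exact: norm_hausdorff.
- by move=> m; apply: continuous_comp; [exact: hSm.1|exact: norm_continuous].
- exact: norm_continuous.
- exact: hHm.1.
- by move=> _ [h _ <-]; rewrite Sm_j (hHm.2 _ _ (SV h)).
Qed.

Lemma Sm_inj : injective Sm.
Proof.
move=> m m' mm'; apply/eqP; rewrite -subr_eq0 -rnorm_eq0 -Sm_isometry.
by rewrite linearB mm' subrr rnorm0.
Qed.

(** On j(H) this is the symmetry of S^{-1}; both sides are continuous in m. *)
Lemma pairE m x : pair m (V x) = dot (Sm m) x.
Proof.
have [pairlin pairj] := hpair.
move: m; apply: (@continuous_dense_eq _ R[i]^o _ _ (range j)).
- exact: norm_hausdorff.
- exact: (pairlin _).2.
- have dlin : linear ((fun m => dot (Sm m) x) : Hm -> R[i]^o).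
    by move=> a m m'; rewrite linearP linearDl linearZl_LR.
  pose d : {linear Hm -> R[i]^o} :=
    HB.pack_for {linear Hm -> R[i]^o} (fun m => dot (Sm m) x : R[i]^o)
      (GRing.isLinear.Build _ _ _ _ _ dlin).
  suff : continuous d by [].
  apply/linear_continuousP; exists (rnorm x + 1) => [|m].
    by rewrite ltr_wpDl ?rnorm_ge0.
  rewrite (le_trans (dot_cauchy_schwarz hH _ _))// mulrC Sm_isometry.
  by rewrite ler_wpM2r ?rnorm_ge0// lerDl.
- exact: hHm.1.
- by move=> _ [h _ <-]; rewrite pairj Sm_j iV_symmetric.
Qed.

(** For x in dom S the vector i (V x) is in dom A0, where A0e is given by A0;
dom S is dense and both sides are continuous. *)
Lemma Sm_A0e x : Sm (A0e (V x)) = x.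
Proof.
have [[_ Sdense _] _ A0E] := hS.
move: x; apply: (@continuous_dense_eq H H (fun x => Sm (A0e (V x))) id (dom S)).
- exact: norm_hausdorff.
- move=> x; apply: (@continuous_comp _ _ _ V (Sm \o A0e)).
    exact: V_continuous.
  by apply: continuous_comp; [exact: hA0e.1|exact: hSm.1].
- by move=> x; exact: cvg_id.
- exact: Sdense.
- move=> x [h Sxh]; have A0x : A0 (i (V x), h).
    rewrite A0E; exists x => //; exact: SV.
  by rewrite (hA0e.2 _ _ A0x); exact: hSm.2 Sxh.
Qed.

Let T x := Sm (D (V x)).

Lemma T_symmetric x y : dot (T x) y = dot x (T y).
Proof.
have [_ _ Tadj] := T_sa.
have gT z : sandwiched S i Sm D (z, T z) by exists (V z) => //=; exact: SV.
have := gT y; rewrite {1}Tadj => /(_ _ _ (gT x)) /= ->; exact: erefl.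
Qed.

(** L(l) = 1 + l T + l^2 A0^{-1}, since i o V = S^{-1} and A0 = S S. *)
Definition pencil (l : R[i]) : {linear H -> H} :=
  idfun \+ l \*: (Sm \o (D \o V)) \+ l ^+ 2 \*: (i \o (V \o (i \o V))).

Lemma pencilE l x :
  pencil l x = x + l *: T x + l ^+ 2 *: i (V (i (V x))).
Proof. by []. Qed.

Lemma pencil_continuous l : continuous (pencil l).
Proof.
have iC := i_continuous; have VC := V_continuous.
have SmC : continuous Sm := hSm.1.
have SDV : continuous (Sm \o (D \o V)).
  move=> x; apply: (@continuous_comp _ _ _ (D \o V) Sm); last exact: SmC.
  by apply: continuous_comp; [exact: VC|exact: D_bounded].
have iV : continuous (i \o V).
  by move=> x; apply: continuous_comp; [exact: VC|exact: iC].
have iViV : continuous (i \o (V \o (i \o V))).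
  by move=> x; apply: (@continuous_comp _ _ _ (i \o V) (i \o V)); exact: iV.
move=> x; apply: cvgD; [apply: cvgD|].
- exact: cvg_id.
- exact: (cvgZl_tmp (SDV x)).
- exact: (cvgZl_tmp (iViV x)).
Qed.

Lemma pencil_adjoint l x y : dot (pencil l x) y = dot x (pencil l^*%C y).
Proof.
rewrite !pencilE !linearDl !linearDr !linearZl_LR !linearZr_LR/=.
have lC : Num.conj l^*%C = l by exact: conjcK.
by rewrite T_symmetric !iV_symmetric rmorphXn/= lC expr2 -mulrA.
Qed.

Definition pencil_value (l : R[i]) (z : Hp) : R[i] :=
  (rnorm z ^+ 2)%:C + l * (re_form pair D z)%:C +
  l ^+ 2 * (rnorm (i z) ^+ 2)%:C.

Lemma pencil_dot l x : dot (pencil l x) x = pencil_value l (V x).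
Proof.
rewrite /pencil_value pencilE !linearDl !linearZl_LR/= (dot_self hH) normV.
rewrite [dot (i _) _]iV_symmetric (dot_self hH) /re_form pairE -/(T x).
rewrite RRe_real//; apply/CrealP.
by rewrite -[LHS]/(conjc _) -dotC -T_symmetric.
Qed.

Lemma pencil_value_conj l z : pencil_value l^*%C z = (pencil_value l z)^*%C.
Proof. exact: conj_quadratic. Qed.

(** For data (f, g) the unknown (z, i w) has w = f + l z and z = V x.  The
isometry Sm turns the remaining equation in H_{-1/2} into
L(l) x = - Y (f, g) in H, where Y collects the terms in f and g. *)
Lemma resolvent_of_pencil l (Q : {linear H -> H}) :
  continuous Q -> cancel (pencil l) Q -> cancel Q (pencil l) ->
  resolvent_set (block_operator i j A0e D) l.
Proof.
move=> Qc LQ QL.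
have iC := i_continuous; have VC := V_continuous.
have SmC : continuous Sm := hSm.1.
pose Y (q : Hp * H) := Sm (D q.1) + i (V q.2) + l *: i (V (i q.1)).
have Yc : continuous Y.
  move=> q; apply: cvgD; [apply: cvgD|].
  - apply: (@continuous_comp _ _ _ fst (Sm \o D)); first exact: cvg_fst.
    by apply: continuous_comp; [exact: D_bounded|exact: SmC].
  - apply: (@continuous_comp _ _ _ snd (i \o V)); first exact: cvg_snd.
    by apply: continuous_comp; [exact: VC|exact: iC].
  - apply: (@cvgZl_tmp _ _ _ _ _ l (fun q => i (V (i q.1)))).
    apply: (@continuous_comp _ _ _ fst (i \o (V \o i))); first exact: cvg_fst.
    apply: (@continuous_comp _ _ _ (V \o i) i); last exact: iC.
    by apply: continuous_comp; [exact: iC|exact: VC].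
have Ylin a p q : Y (a *: p + q) = a *: Y p + Y q.
  rewrite /Y /= !linearP/= !scalerDr.
  by rewrite [X in X + _ = _]addrACA [LHS]addrACA.
pose X q := Q (- Y q).
have Xc : continuous X.
  move=> q; apply: (@continuous_comp _ _ _ (fun q => - Y q) Q); last exact: Qc.
  by apply: cvgN; exact: Yc.
have Xlin a p q : X (a *: p + q) = a *: X p + X q.
  by rewrite /X Ylin opprD -scalerN linearP.
pose F (q : Hp * H) := (V (X q), i (q.1 + l *: V (X q))).
have VXc : continuous (V \o X).
  by move=> q; apply: continuous_comp; [exact: Xc|exact: VC].
have Fc : continuous F.
  move=> q; apply: cvg_pair; first exact: VXc.
  apply: (@continuous_comp _ _ _ (fun q => q.1 + l *: V (X q)) i); last exact: iC.
  by apply: cvgD; [exact: cvg_fst|exact: (cvgZl_tmp (VXc q))].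
have Flin : linear F.
  move=> a p q; rewrite /F Xlin !linearP/=; congr (_, _).
  by rewrite addrACA -scalerDr linearP.
pose Fl := HB.pack_for {linear (Hp * H)%type -> (Hp * H)%type} F
  (GRing.isLinear.Build _ _ _ _ F Flin).
have key x f g :
    Sm (j (g + l *: i (f + l *: V x)) + A0e (V x) + D (f + l *: V x)) =
    pencil l x + Y (f, g).
  rewrite linearD linearD Sm_j Sm_A0e pencilE /Y/= !(linearD, linearZ)/=.
  by rewrite scalerDr scalerA -expr2 (AC ((1*2)*1*2) (4*6*3*(5*1*2))).
have equiv x f g : j (g + l *: i (f + l *: V x)) =
    - A0e (V x) - D (f + l *: V x) <-> x = X (f, g).
  rewrite -opprD; split=> [/eqP|xE].
    rewrite -addr_eq0 addrA => /eqP m0.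
    rewrite -[LHS](LQ x); congr (Q _); apply/eqP.
    by rewrite -addr_eq0 -(key x f g) m0 linear0.
  apply/eqP; rewrite -addr_eq0 addrA; apply/eqP/Sm_inj.
  by rewrite key linear0 {1}xE QL addNr.
exists Fl => //; apply/seteqP; split => [[[f g] p]|[[f g] p]] /=.
  move=> [z [w [h [[pE wE hE] jE]]]].
  move: wE hE jE; rewrite pE/= => <- <-.
  have [x ->] := surjV z => /equiv xE.
  by rewrite /F -xE.
move=> ->; exists (V (X (f, g))), (f + l *: V (X (f, g))).
exists (g + l *: i (f + l *: V (X (f, g)))); split=> //.
exact/equiv.
Qed.

Lemma resolvent_of_coercive l (c : R) : 0 < c ->
  (forall z, c * rnorm z ^+ 2 <= complex.Re `|pencil_value l z|) ->
  resolvent_set (block_operator i j A0e D) l.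
Proof.
move=> c0 lc.
have below l' : (forall z, c * rnorm z ^+ 2 <= complex.Re `|pencil_value l' z|) ->
    forall x, c * rnorm x <= rnorm (pencil l' x).
  move=> l'c x; have [->|x0] := eqVneq x 0.
    by rewrite rnorm0 mulr0 rnorm_ge0.
  have xp : 0 < rnorm x by rewrite rnorm_gt0.
  rewrite -(ler_pM2r xp) -mulrA -expr2 -{1}normV (le_trans (l'c _))//.
  by rewrite -pencil_dot dot_cauchy_schwarz.
have lc' z : c * rnorm z ^+ 2 <= complex.Re `|pencil_value l^*%C z|.
  by rewrite pencil_value_conj normcJ.
have [Q [Qc LQ QL]] := bijective_of_bounded_below hH (pencil_adjoint l)
  (@pencil_continuous l) c0 (below _ lc) (below _ lc').
exact: resolvent_of_pencil Qc LQ QL.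
Qed.

(** The pairs (<Tx, x>, |S^{-1} x|^2) for unit vectors x, written in terms of
z = V x. *)
Definition ratios : set (R * R) :=
  [set (re_form pair D z / rnorm z ^+ 2, rnorm (i z) ^+ 2 / rnorm z ^+ 2)
  | z in [set z : Hp | z != 0]].

Hypothesis D_accretive : forall z : Hp, 0 <= complex.Re (pair (D z) z).

(** At a spectral point the numerical values of L(l) are not bounded away from
0, and the ratios stay in a bounded box since T and S^{-1} are bounded. *)
Lemma spectrum_root l : spectrum (block_operator i j A0e D) l ->
  exists2 p, closure ratios p & qeval l p = 0.
Proof.
move=> lspec.
have [K K0 TK] : exists2 K, 0 < K &
    forall x, rnorm ((Sm \o (D \o V)) x) <= K * rnorm x.
  apply/(linear_continuousP (Sm \o (D \o V))) => x.
  apply: (@continuous_comp _ _ _ (D \o V) Sm); last exact: hSm.1.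
  by apply: continuous_comp; [exact: V_continuous|exact: D_bounded].
apply: (@root_in_closure _ _ (K + a0 ^- 2)).
  move=> _ [z z0 <-] /=; have zp : 0 < rnorm z by rewrite rnorm_gt0.
  have zp2 : 0 < rnorm z ^+ 2 by rewrite exprn_gt0.
  have a2 : 0 < a0 ^- 2 by rewrite invr_gt0 exprn_gt0.
  split; apply/andP; split; rewrite ?divr_ge0 ?sqr_ge0 ?D_accretive//.
    rewrite ler_pdivrMr//; have [x zE] := surjV z.
    rewrite (@le_trans _ _ (K * rnorm z ^+ 2))//; last first.
      by rewrite ler_wpM2r ?(ltW zp2)// lerDl ltW.
    rewrite zE /re_form pairE normV.
    apply: (@le_trans _ _ (complex.Re `|dot (T x) x|)).
      by rewrite -lecR -modulusE (le_trans _ (normc_ge_Re _))// lecR ler_norm.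
    by rewrite (le_trans (dot_cauchy_schwarz hH _ _))// expr2 mulrA ler_wpM2r
      ?rnorm_ge0.
  apply: (@le_trans _ _ (a0 ^- 2)); last by rewrite lerDr ltW.
  rewrite ler_pdivrMr// ler_pdivlMl ?exprn_gt0// -exprMn.
  by rewrite ler_pXn2r ?nnegrE ?mulr_ge0 ?rnorm_ge0 ?(ltW a0_gt0)// i_bound.
move=> c c0; apply: contrapT => nsmall; apply: lspec.
apply: (resolvent_of_coercive c0) => z; have [->|z0] := eqVneq z 0.
  by rewrite rnorm0 expr0n mulr0 modulus_ge0.
have zp : 0 < rnorm z ^+ 2 by rewrite exprn_gt0// rnorm_gt0.
pose p := (re_form pair D z / rnorm z ^+ 2, rnorm (i z) ^+ 2 / rnorm z ^+ 2).
have -> : pencil_value l z = (rnorm z ^+ 2)%:C * qeval l p.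
  by apply: qeval_scale; rewrite gt_eqF.
have -> : complex.Re `|(rnorm z ^+ 2)%:C * qeval l p| =
    complex.Re `|qeval l p| * rnorm z ^+ 2.
  apply: complexI; rewrite [RHS]rmorphM -!modulusE normrM mulrC.
  by congr (_ * _); rewrite ger0_norm// ler0c ltW.
rewrite ler_wpM2r ?(ltW zp)// leNgt; apply/negP => small.
by apply: nsmall; exists p => //; exists z.
Qed.

End operators.

(** * The constants as inequalities on the closed set of ratios *)

Lemma inf_ratio_le (R : realType) (T : Type) (P : set T) (f g : T -> R)
    (x : T) :
  (forall z, P z -> 0 <= f z) -> (forall z, P z -> 0 < g z) -> P x ->
  inf [set f z / g z | z in P] * g x <= f x.
Proof.
move=> f0 g0 Px; rewrite -ler_pdivlMr ?g0//; apply: ge_inf; last by exists x.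
by exists 0 => _ [z Pz <-]; rewrite divr_ge0 ?f0// ltW// g0.
Qed.

Lemma le_inf_ratio (R : realType) (T : Type) (P : set T) (f g : T -> R)
    (c : R) :
  (forall z, P z -> 0 < g z) -> P !=set0 ->
  (forall z, P z -> c * g z <= f z) -> c <= inf [set f z / g z | z in P].
Proof.
move=> g0 [x Px] cgf; apply: lb_le_inf; first by exists (f x / g x), x.
by move=> _ [z Pz <-]; rewrite ler_pdivlMr ?g0// cgf.
Qed.

(** The infimum of the empty set is 0. *)
Lemma inf_ratio_neq0 (R : realType) (T : Type) (P : set T) (f g : T -> R) :
  0 < inf [set f z / g z | z in P] -> P !=set0.
Proof.
move=> h; apply/set0P/negP => /eqP P0.
by move: h; rewrite P0 image_set0 inf0 ltxx.
Qed.

Lemma quadratic_continuous (R : realType) (k a b c : R) :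
  continuous (fun p : R * R => k * (p.1 * p.1) + a * p.1 + b * p.2 + c).
Proof.
move=> p.
have c1 : fst @ nbhs (p : R * R) --> p.1 by exact: cvg_fst.
have c2 : snd @ nbhs (p : R * R) --> p.2 by exact: cvg_snd.
apply: cvgD; [apply: cvgD; [apply: cvgD|]|exact: cvg_cst].
- by apply: cvgMl_tmp; apply: cvgM; exact: c1.
- by apply: cvgMl_tmp; exact: c1.
- by apply: cvgMl_tmp; exact: c2.
Qed.

Section constants.
Context {R : realType} (H Hp Hm : completeNormedModType R[i]).
Context (i : {linear Hp -> H}) (pair : Hm -> Hp -> R[i]).
Context (D : {linear Hp -> Hm}) (a0 : R).
Hypothesis i_inj : injective i.
Hypothesis a0_gt0 : 0 < a0.
Hypothesis i_bound : forall z, a0 * rnorm (i z) <= rnorm z.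
Hypothesis D_accretive : forall z : Hp, 0 <= re_form pair D z.

Lemma rnorm_i_gt0 z : z != 0 -> 0 < rnorm (i z).
Proof. by move=> z0; rewrite rnorm_gt0 -(linear0 i) (inj_eq i_inj). Qed.

Lemma beta_le z : z != 0 ->
  beta i pair D * rnorm (i z) ^+ 2 <= re_form pair D z.
Proof.
apply: (@inf_ratio_le _ _ [set z : Hp | z != 0] _
  (fun z => rnorm (i z) ^+ 2)) => //.
by move=> w w0; rewrite exprn_gt0 ?rnorm_i_gt0.
Qed.

Lemma delta_le z : z != 0 -> delta pair D * rnorm z ^+ 2 <= re_form pair D z.
Proof.
apply: (@inf_ratio_le _ _ [set z : Hp | z != 0] _
  (fun z => rnorm z ^+ 2)) => //.
by move=> w w0; rewrite exprn_gt0 ?rnorm_gt0.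
Qed.

Lemma mu_le z : z != 0 ->
  mu i pair D * (rnorm (i z) * rnorm z) <= re_form pair D z.
Proof.
apply: (@inf_ratio_le _ _ [set z : Hp | z != 0] _
  (fun z => rnorm (i z) * rnorm z)) => //.
by move=> w w0; rewrite mulr_gt0 ?rnorm_i_gt0 ?rnorm_gt0.
Qed.

Lemma gamma_ge z : (gamma i pair D < +oo)%E -> z != 0 ->
  re_form pair D z <= fine (gamma i pair D) * rnorm (i z) ^+ 2.
Proof.
move=> goo z0; rewrite -ler_pdivrMr ?exprn_gt0 ?rnorm_i_gt0//.
have : ((re_form pair D z / rnorm (i z) ^+ 2)%:E <= gamma i pair D)%E.
  by apply: ereal_sup_ubound; exists z.
by move: goo; case: (gamma i pair D) => //= r _; rewrite ?lee_fin.
Qed.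

Lemma mu_beta : 0 < mu i pair D -> mu i pair D * a0 <= beta i pair D.
Proof.
move=> mu0; apply: (le_inf_ratio _ (inf_ratio_neq0 mu0)) => z z0.
  by rewrite exprn_gt0 ?rnorm_i_gt0.
rewrite (le_trans _ (mu_le z0))// -mulrA ler_pM2l// expr2 mulrA mulrC.
by rewrite ler_wpM2l ?rnorm_ge0.
Qed.

Lemma delta_beta : 0 < delta pair D -> delta pair D * a0 ^+ 2 <= beta i pair D.
Proof.
move=> d0; apply: (le_inf_ratio _ (inf_ratio_neq0 d0)) => z z0.
  by rewrite exprn_gt0 ?rnorm_i_gt0.
rewrite (le_trans _ (delta_le z0))// -mulrA ler_pM2l// -exprMn.
by rewrite ler_pXn2r ?nnegrE ?mulr_ge0 ?rnorm_ge0// ltW.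
Qed.

Section closure.
Variable p : R * R.
Hypothesis pW : closure (ratios i pair D) p.

(** A quadratic polynomial in (t, b) that is nonnegative on the ratios is so on
their closure; the hypothesis is that inequality multiplied by |z|^4. *)
Lemma closure_quadratic (k a b c : R) :
  (forall z, z != 0 -> let n := rnorm z ^+ 2 in
    0 <= k * re_form pair D z ^+ 2 + a * (re_form pair D z * n) +
      b * (rnorm (i z) ^+ 2 * n) + c * n ^+ 2) ->
  0 <= k * (p.1 * p.1) + a * p.1 + b * p.2 + c.
Proof.
move=> h; move: p pW; apply: closure_ge0.
  exact: (@quadratic_continuous _ k a b c).
move=> _ [z /= z0 <-] /=; have := h z z0 => /=.
have n0 : 0 < rnorm z ^+ 2 by rewrite exprn_gt0 ?rnorm_gt0.
set n := rnorm z ^+ 2 in n0 *; set t := re_form _ _ _.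
set b' := rnorm (i z) ^+ 2.
move=> le0; rewrite -(pmulr_lge0 _ (exprn_gt0 2 n0)).
suff -> : (k * (t / n * (t / n)) + a * (t / n) + b * (b' / n) + c) * n ^+ 2 =
  k * t ^+ 2 + a * (t * n) + b * (b' * n) + c * n ^+ 2 by [].
by field; rewrite gt_eqF.
Qed.

Lemma closure_t : 0 <= p.1.
Proof.
have := @closure_quadratic 0 1 0 0; rewrite !mul0r !mul1r add0r !addr0; apply.
by move=> z z0; rewrite /= !mul0r add0r !addr0 mul1r mulr_ge0 ?sqr_ge0.
Qed.

Lemma closure_b : 0 <= p.2.
Proof.
have := @closure_quadratic 0 0 1 0; rewrite !mul0r !mul1r !add0r !addr0; apply.
by move=> z z0; rewrite /= !mul0r !add0r !addr0 mul1r mulr_ge0 ?sqr_ge0.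
Qed.

Lemma closure_beta : beta i pair D * p.2 <= p.1.
Proof.
suff : 0 <= 0 * (p.1 * p.1) + 1 * p.1 + - beta i pair D * p.2 + 0 by lra.
apply: closure_quadratic => z z0 /=.
have := ler_wpM2r (sqr_ge0 (rnorm z)) (beta_le z0); lra.
Qed.

Lemma closure_delta : delta pair D <= p.1.
Proof.
suff : 0 <= 0 * (p.1 * p.1) + 1 * p.1 + 0 * p.2 + - delta pair D by lra.
apply: closure_quadratic => z z0 /=.
have := ler_wpM2r (sqr_ge0 (rnorm z)) (delta_le z0); lra.
Qed.

Lemma closure_mu : 0 < mu i pair D -> mu i pair D ^+ 2 * p.2 <= p.1 ^+ 2.
Proof.
move=> mu0.
suff : 0 <= 1 * (p.1 * p.1) + 0 * p.1 + - mu i pair D ^+ 2 * p.2 + 0 by lra.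
apply: closure_quadratic => z z0 /=.
have : (mu i pair D * (rnorm (i z) * rnorm z)) ^+ 2 <= re_form pair D z ^+ 2.
  by rewrite ler_pXn2r ?nnegrE ?mu_le// !mulr_ge0 ?rnorm_ge0// ltW.
lra.
Qed.

Lemma closure_gamma : (gamma i pair D < +oo)%E ->
  p.1 <= fine (gamma i pair D) * p.2.
Proof.
move=> goo.
suff : 0 <= 0 * (p.1 * p.1) + -1 * p.1 + fine (gamma i pair D) * p.2 + 0 by lra.
apply: closure_quadratic => z z0 /=.
have := ler_wpM2r (sqr_ge0 (rnorm z)) (gamma_ge goo z0); lra.
Qed.

End closure.
End constants.


(** * Enclosures of the spectrum *)

(** Multiplying by 1 / d and completing the square gives
(u + 1/d)^2 + v^2 <= 1/d^2. *)
Lemma left_disk (R : realType) (u v d : R) : 0 < d ->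
  d * (u ^+ 2 + v ^+ 2) + 2 * u <= 0 ->
  - (2 / d) <= u /\ `|(u +i* v) + (d^-1)%:C| <= (d^-1)%:C.
Proof.
move=> d0 disk.
have dV : 0 < d^-1 by rewrite invr_gt0.
have E : (u + d^-1) ^+ 2 + v ^+ 2 <= d^-1 ^+ 2.
  have := ler_wpM2l (ltW dV) disk; rewrite mulr0 mulrDr mulKf ?gt_eqF//.
  by nra.
have le_root : Num.sqrt ((u + d^-1) ^+ 2 + (v + 0) ^+ 2) <= d^-1.
  by rewrite addr0 -[leRHS](ger0_norm (ltW dV)) -sqrtr_sqr ler_sqrt// sqr_ge0.
split; last by rewrite normc_def/= lecR.
have : (u + d^-1) ^+ 2 <= d^-1 ^+ 2 by have := sqr_ge0 v; lra.
rewrite -subr_ge0; have -> : 2 / d = d^-1 + d^-1 by rewrite mulr_natl mulr2n.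
by nra.
Qed.

(** The two bounds are the roots of u^2 + be u + be / d, which is negative
strictly between them. *)
Lemma quadratic_gap (R : realType) (be d u : R) :
  0 < be -> 0 < d -> 4 < be * d -> 0 <= u ^+ 2 + be * u + be / d ->
  let r := Num.sqrt (1 - 4 / (be * d)) in
  u <= - (be / 2 * (1 + r)) \/ - (be / 2 * (1 - r)) <= u.
Proof.
move=> be0 d0 bd q0 r.
have r0 : 0 <= r by exact: sqrtr_ge0.
have r2 : r ^+ 2 = 1 - 4 / (be * d).
  by rewrite sqr_sqrtr// subr_ge0 ler_pdivrMr ?mulr_gt0// mul1r ltW.
have E : be / d = (be / 2) ^+ 2 * (1 - r ^+ 2).
  by rewrite r2; field; rewrite ?gt_eqF.
have [h|h] := lerP u (- (be / 2 * (1 + r))); first by left.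
right; rewrite leNgt; apply/negP => h2.
have : 0 < (u + be / 2 * (1 + r)) * (- (be / 2 * (1 - r)) - u).
  by rewrite mulr_gt0; lra.
by move: q0; rewrite E; lra.
Qed.

Theorem theorem7p2 (R : realType)
  (H : completeNormedModType R[i]) (dot : {dot H for Num.conj})
  (A0 S : set (H * H)) (a0 : R)
  (Hp Hm : completeNormedModType R[i])
  (i : {linear Hp -> H}) (j : {linear H -> Hm})
  (pair : Hm -> Hp -> R[i])
  (Sm : {linear Hm -> H}) (A0e D : {linear Hp -> Hm})
  (hH : norm_from_dot dot)
  (A0_sa : self_adjoint dot A0)
  (A0_pos : uniformly_positive dot A0)
  (A0_res : resolvent_set A0 0)
  (hS : is_sqrt_operator dot A0 S)
  (a0_gt0 : 0 < a0)
  (ha0 : forall x h : H, S (x, h) -> a0 * rnorm x <= rnorm h)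
  (hHp : is_half_space S i)
  (hHm : is_minus_half_space S j)
  (hpair : is_duality_pairing dot i j pair)
  (hSm : extends_inv_sqrt S j Sm)
  (hA0e : extends_A0 A0 i j A0e)
  (D_bounded : continuous D)
  (D_accretive : forall z : Hp, 0 <= complex.Re (pair (D z) z))
  (D_H1 : forall z : Hp, dom A0 (i z) -> range j (D z))
  (T_bounded : bounded_operator (sandwiched S i Sm D))
  (T_sa : self_adjoint dot (sandwiched S i Sm D)) :
  let sigma := spectrum (block_operator i j A0e D) in
  let beta := beta i pair D in
  let gamma := gamma i pair D in
  let delta := delta pair D in
  let mu := mu i pair D in
  (0 < beta ->
    sigma `<=` [set lambda | complex.Re lambda <= - (beta / 2)]
               `|` on_real_line `[- (beta / 2), 0[) /\
  (0 < mu < 2 ->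
    [/\ mu * a0 <= beta, 0 < mu * a0 &
        sigma `<=`
          [set lambda | complex.Re lambda <= - (beta / 2) /\
             `|complex.Im lambda| <=
               Num.sqrt (4 - mu ^+ 2) / mu * `|complex.Re lambda|]
          `|` on_real_line `[- (beta / 2), 0[]) /\
  (2 <= mu -> sigma `<=` on_real_line `]-oo, 0[) /\
  (0 < delta ->
    let disk_part :=
      [set lambda : R[i] |
        - (2 / delta) <= complex.Re lambda <= - (beta / 2) /\
        `|lambda + (delta^-1)%:C| <= (delta^-1)%:C] in
    [/\ delta * a0 ^+ 2 <= beta /\ 0 < delta * a0 ^+ 2,
        bounded_set (sigma `\` on_real_line [set: R] : set R[i]^o),
        sigma `\` on_real_line [set: R] `<=` disk_part,
        sigma `<=` on_real_line `]-oo, - (2 / delta)]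
                   `|` disk_part
                   `|` on_real_line `[- (beta / 2), 0[ &
        4 < beta * delta ->
          let r := Num.sqrt (1 - 4 / (beta * delta)) in
          sigma `<=` on_real_line `]-oo, - (beta / 2 * (1 + r))]
                     `|` on_real_line `[- (beta / 2 * (1 - r)), 0[]) /\
  ([\/ 0 < beta, 0 < mu < 2, 2 <= mu | 0 < delta] ->
    (gamma < +oo)%E ->
    let g := fine gamma in
    sigma `<=` on_real_line `[- g, - (g / 2)]
               `|` [set lambda | - (g / 2) <= complex.Re lambda < 0]).
Proof.
move=> sigma be ga de m.
have [V [SV normV surjV]] := half_space_isometry A0_res hS hHp.
have [i_inj _ _] := hHp.
have i_bd := i_bound ha0 SV normV surjV.
have root u v : sigma (u +i* v) -> exists t b : R,
    [/\ 0 <= t, 0 <= b, closure (ratios i pair D) (t, b) &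
        qeval (u +i* v) (t, b) = 0].
  move=> /(spectrum_root hH hS a0_gt0 ha0 hHm hpair hSm hA0e D_bounded T_sa
    SV normV surjV D_accretive)[[t b] W q0].
  exists t, b; split=> //.
    exact: closure_t D_accretive _ W.
  exact: closure_b W.
have real_left X u v : v = 0 -> X u -> on_real_line X (u +i* v).
  by move=> -> Xu; exists u.
have beta_set l : 0 < be -> sigma l ->
    complex.Re l <= - (be / 2) \/ on_real_line `[- (be / 2), 0[ l.
  move: l => [u v] be0 /root[t [b [t0 b0 W q0]]].
  have bt : be * b <= t := closure_beta i_inj D_accretive W.
  have [v0|v0] := eqVneq v 0; last first.
    by left; exact: (nonreal_root_beta b0 q0 bt v0).
  have [u0 _] := real_root b0 t0 q0 v0.
  have [h|h] := lerP u (- (be / 2)); first by left.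
  by right; apply: real_left => //; rewrite /= in_itv/= (ltW h).
have m_le_be : 0 < m -> m * a0 <= be by apply: mu_beta.
have d_le_be : 0 < de -> de * a0 ^+ 2 <= be by apply: delta_beta.
split; [|split; [|split; [|split]]].
- by move=> be0 l /beta_set; apply.
- move=> /andP[m0 m2]; have ma0 : 0 < m * a0 by rewrite mulr_gt0.
  have be0 : 0 < be := lt_le_trans ma0 (m_le_be m0).
  split; [exact: m_le_be|by []|].
  move=> [u v] sl; have [bl|br] := beta_set _ be0 sl; last by right.
  left; split=> //=; have [t [b [t0 b0 W q0]]] := root _ _ sl.
  have [->|v0] := eqVneq v 0.
    by rewrite normr0 !mulr_ge0 ?invr_ge0 ?sqrtr_ge0 ?(ltW m0).
  have mt : m ^+ 2 * b <= t ^+ 2 := closure_mu i_inj D_accretive W m0.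
  have k := nonreal_root_mu b0 q0 m0 mt v0.
  have m4 : 0 <= 4 - m ^+ 2 by nra.
  rewrite -(@ler_pXn2r _ 2) ?nnegrE ?mulr_ge0 ?invr_ge0 ?sqrtr_ge0 ?(ltW m0)//.
  rewrite !exprMn sqr_sqrtr// !real_normK ?num_real// exprVn mulrAC.
  by rewrite ler_pdivlMr ?exprn_gt0// mulrC.
- move=> m2 [u v] sl; have m0 : 0 < m by rewrite (lt_le_trans _ m2).
  have [t [b [t0 b0 W q0]]] := root _ _ sl.
  have [v0|v0] := eqVneq v 0.
    have [u0 _] := real_root b0 t0 q0 v0.
    by apply: real_left => //=; rewrite in_itv.
  have mt : m ^+ 2 * b <= t ^+ 2 := closure_mu i_inj D_accretive W m0.
  have k := nonreal_root_mu b0 q0 m0 mt v0.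
  have v2 : 0 < v ^+ 2 by rewrite exprn_even_gt0.
  exfalso; have : 0 < m ^+ 2 * v ^+ 2 by rewrite mulr_gt0// exprn_gt0.
  have : (4 - m ^+ 2) * u ^+ 2 <= 0 by rewrite mulr_le0_ge0 ?sqr_ge0//; nra.
  by lra.
- move=> d0 disk_part.
  have da0 : 0 < de * a0 ^+ 2 by rewrite mulr_gt0// exprn_gt0.
  have be0 : 0 < be := lt_le_trans da0 (d_le_be d0).
  have in_disk u v : sigma (u +i* v) -> v != 0 -> disk_part (u +i* v).
    move=> /root[t [b [t0 b0 W q0]]] v0.
    have bt : be * b <= t := closure_beta i_inj D_accretive W.
    have dt : de <= t := closure_delta D_accretive W.
    have [d1 d2] := left_disk d0 (nonreal_root_delta b0 q0 d0 dt v0).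
    by split=> //=; rewrite d1 (nonreal_root_beta b0 q0 bt v0).
  have nonreal_disk : sigma `\` on_real_line [set: R] `<=` disk_part.
    move=> [u v] [sl nr]; apply: in_disk => //; apply/eqP => v0.
    by apply: nr; exact: real_left.
  split; [by split=> //; exact: d_le_be| |exact: nonreal_disk| |].
  + exists (2 / de)%:C; split; first by apply/complex_realP; exists (2 / de).
    move=> M hM l /nonreal_disk[_ hl]; apply: (le_trans _ (ltW hM)).
    rewrite -[l](addrK (de^-1)%:C) (le_trans (ler_normB _ _))//.
    rewrite [X in _ + X]ger0_norm ?ler0c ?invr_ge0 ?(ltW d0)//.
    have -> : (2 / de)%:C = (de^-1)%:C + (de^-1)%:C.
      by rewrite -rmorphD/= mulr_natl mulr2n.
    by rewrite lerD2r.
  + move=> [u v] sl; have [v0|v0] := eqVneq v 0; last first.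
      by left; right; exact: in_disk.
    have [t [b [t0 b0 W q0]]] := root _ _ sl.
    have [u0 _] := real_root b0 t0 q0 v0.
    have [h1|h1] := lerP u (- (2 / de)).
      by left; left; apply: real_left => //; rewrite /= in_itv.
    have [h2|h2] := lerP u (- (be / 2)); last first.
      by right; apply: real_left => //; rewrite /= in_itv/= (ltW h2).
    left; right; rewrite /disk_part/= (ltW h1) h2; split=> //.
    apply: (proj2 (left_disk d0 _)); rewrite v0 expr0n addr0.
    have : 0 <= de * (u + 2 / de) by rewrite mulr_ge0// ?ltW// -ltrBlDr sub0r.
    have -> : de * (u + 2 / de) = de * u + 2 by field; rewrite gt_eqF.
    by nra.
  + move=> bd r [u v] /root[t [b [t0 b0 W q0]]].
    have bt : be * b <= t := closure_beta i_inj D_accretive W.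
    have dt : de <= t := closure_delta D_accretive W.
    have [v0 u0 E] := root_beta_delta b0 t0 q0 be0 d0 bd bt dt.
    have [h|h] := quadratic_gap be0 d0 bd E; [left|right].
      by apply: real_left => //; rewrite /= in_itv.
    by apply: real_left => //; rewrite /= in_itv/= h.
- move=> cases goo g [u v] /root[t [b [t0 b0 W q0]]].
  (* Each of the four cases makes beta positive; then t > 0 for a nonreal root,
     which puts it strictly to the left of the imaginary axis. *)
  have be0 : 0 < be.
    case: cases => [//|/andP[m0 _]|m2|d0].
    + by rewrite (lt_le_trans _ (m_le_be m0))// mulr_gt0.
    + have m0 : 0 < m by rewrite (lt_le_trans _ m2).
      by rewrite (lt_le_trans _ (m_le_be m0))// mulr_gt0.
    + by rewrite (lt_le_trans _ (d_le_be d0))// mulr_gt0// exprn_gt0.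
  have bt : be * b <= t := closure_beta i_inj D_accretive W.
  have tg : t <= g * b := closure_gamma i_inj W goo.
  have [[v0 /andP[gu u0]]|[v0 gu]] := root_gamma b0 t0 q0 tg; last first.
    right; rewrite /= gu/=; have [bp tE _] := nonreal_root b0 q0 v0.
    have : 0 < t by rewrite (lt_le_trans _ bt)// mulr_gt0.
    by rewrite tE; nra.
  have [h|h] := lerP u (- (g / 2)); last by right; rewrite /= (ltW h).
  by left; apply: real_left => //; rewrite /= in_itv/= gu.
Qed.
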